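(* Let $S$ be a hyperbolic space and let $G\le \operatorname{Isom}(S)$ be a countable subgroup of general type. Then the action of the Frattini subgroup $\Phi(G)$ on $S$ has bounded orbits. In particular, $|G:\Phi(G)|=\infty$.
   Context: The Frattini subgroup $\Phi(G)$ of a group $G$ is the intersection of all maximal subgroups of $G$; if $G$ has no maximal subgroups, $\Phi(G)=G$. Equivalently, $\Phi(G)$ is the set of all $g\in G$ such that for every generating set $X$ of $G$, the set $X\setminus\{g\}$ also generates $G$. A hyperbolic space is a Gromov hyperbolic metric space; it is not assumed to be proper. For $x,y,z\in S$ the Gromov product is $(x,y)_z=\frac12(d(x,z)+d(y,z)-d(x,y))$. A sequence $(x_i)$ in $S$ converges at infinity if $(x_i,x_j)_s\to\infty$ as $i,j\to\infty$ for some (equivalently, any) $s\in S$; two such sequences $(x_i),(y_i)$ are equivalent if $(x_i,y_j)_s\to\infty$ as $i,j\to\infty$. The Gromov boundary $\partial S$ is the set of equivalence classes, and $\widehat S=S\cup\partial S$ carries the usual topology extending that of $S$, in which $S$ is dense and a sequence converging at infinity converges to its class. Isometric actions on $S$ extend to continuous actions on $\widehat S$. The limit set $\Lambda(G)$ of a group $G$ acting isometrically on $S$ is the intersection of $\partial S$ with the closure in $\widehat S$ of the orbit $Gs$ (this is independent of $s\in S$). A subgroup $G\le\operatorname{Isom}(S)$ is non-elementary if $\Lambda(G)$ contains more than $2$ points; it is of general type if it is non-elementary and does not fix any point of $\partial S$. *)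

(* Defs.v *)
From HB Require Import structures.
From mathcomp Require Import all_boot all_order all_algebra.
From mathcomp Require Import all_classical all_reals all_analysis.

Set Implicit Arguments.
Unset Strict Implicit.
Unset Printing Implicit Defensive.

Import Order.TTheory GRing.Theory Num.Theory.
Import numFieldNormedType.Exports.

Local Open Scope classical_set_scope.
Local Open Scope ring_scope.

Section Groups.
Context (T : groupType).
Implicit Types G H M X : set T.

Definition subgroup G : Prop := group_closed (mem G).

Definition maximal_subgroup G M : Prop :=
  [/\ subgroup M, M `<` G &
      forall H, subgroup H -> M `<=` H -> H `<=` G -> H = M \/ H = G].

(* The intersection of an empty family is [setT], so that [frattini G] is [G]
   when [G] has no maximal subgroup. *)
Definition frattini G : set T :=
  G `&` \bigcap_(M in maximal_subgroup G) M.

Definition left_cosets G H : set (set T) :=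
  [set [set (g * h)%g | h in H] | g in G].

End Groups.

Section Isometries.
Context (R : realType) (S : metricType R).

Definition isometric (f : S -> S) : Prop :=
  forall x y, mdist (f x) (f y) = mdist x y.

Record isom := Isom {
  isom_fun :> S -> S ;
  isom_subproof : `[< isometric isom_fun /\ bijective isom_fun >] }.

HB.instance Definition _ := [isSub for isom_fun].
HB.instance Definition _ := [Choice of isom by <:].

Lemma isom_dist (f : isom) : isometric f.
Proof. by have /asboolP[] := isom_subproof f. Qed.

Lemma isom_bij (f : isom) : bijective f.
Proof. by have /asboolP[] := isom_subproof f. Qed.

Lemma isomP (f g : isom) : f =1 g -> f = g.
Proof. by move=> fg; apply/val_inj/funext. Qed.

Lemma isom_one_subproof : `[< isometric (@id S) /\ bijective (@id S) >].
Proof. by apply/asboolP; split=> //; exists id. Qed.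
Definition isom_one : isom := Isom isom_one_subproof.

Lemma isom_mul_subproof (f g : isom) :
  `[< isometric (f \o g) /\ bijective (f \o g) >].
Proof.
apply/asboolP; split; last exact: bij_comp (isom_bij f) (isom_bij g).
by move=> x y /=; rewrite !isom_dist.
Qed.
Definition isom_mul (f g : isom) : isom := Isom (isom_mul_subproof f g).

Lemma isom_inv_exists (f : isom) :
  exists g : isom, cancel f g /\ cancel g f.
Proof.
have [g fK gK] := isom_bij f.
have g_isom : `[< isometric g /\ bijective g >].
  apply/asboolP; split; last by exists f.
  by move=> x y; rewrite -(isom_dist f) !gK.
by exists (Isom g_isom).
Qed.
Definition isom_inv (f : isom) : isom := projT1 (cid (isom_inv_exists f)).

Lemma isom_invK (f : isom) : cancel f (isom_inv f).
Proof. by rewrite /isom_inv; case: cid => g []. Qed.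

Lemma isom_invKV (f : isom) : cancel (isom_inv f) f.
Proof. by rewrite /isom_inv; case: cid => g []. Qed.

Lemma isom_mulA : associative isom_mul.
Proof. by move=> f g h; exact: isomP. Qed.
Lemma isom_mul1 : left_id isom_one isom_mul.
Proof. by move=> f; exact: isomP. Qed.
Lemma isom_1mul : right_id isom_one isom_mul.
Proof. by move=> f; exact: isomP. Qed.
Lemma isom_mulV : left_inverse isom_one isom_inv isom_mul.
Proof. by move=> f; apply: isomP => x /=; rewrite isom_invK. Qed.
Lemma isom_Vmul : right_inverse isom_one isom_inv isom_mul.
Proof. by move=> f; apply: isomP => x /=; rewrite isom_invKV. Qed.

HB.instance Definition _ :=
  isGroup.Build isom isom_mulA isom_mul1 isom_1mul isom_mulV isom_Vmul.

Definition orbit_of (G : set isom) (s : S) : set S := [set g s | g in G].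

Definition metric_bounded (A : set S) : Prop :=
  exists r : R, forall x y, A x -> A y -> mdist x y <= r.

Definition bounded_orbits (G : set isom) : Prop :=
  forall s, metric_bounded (orbit_of G s).

End Isometries.

Section Hyperbolic.
Context (R : realType) (S : metricType R).
Implicit Types (x y z s : S) (u v : nat -> S).

Definition gromov_prod x y z : R :=
  (mdist x z + mdist y z - mdist x y) / 2.

Definition hyperbolic : Prop :=
  exists delta : R, forall x y z s,
    Num.min (gromov_prod x y s) (gromov_prod y z s) - delta
      <= gromov_prod x z s.

Definition gromov_diverge u v : Prop :=
  exists s, gromov_prod (u ij.1) (v ij.2) s @[ij --> (\oo, \oo)] --> +oo.

Definition converges_at_infinity u : Prop := gromov_diverge u u.

Definition boundary_class u : set (nat -> S) :=
  [set v | converges_at_infinity v /\ gromov_diverge u v].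

Definition gromov_boundary : set (set (nat -> S)) :=
  [set boundary_class u | u in converges_at_infinity].

Definition bordification : Type := (S + gromov_boundary)%type.

Definition approximates u (p : bordification) : Prop :=
  match p with
  | inl x => u @ \oo --> x
  | inr xi => val xi u
  end.

(* The extension of the Gromov product to the bordification, as in Bridson and
   Haefliger, III.H.3.15: the supremum of
     liminf_(i, j -> oo) (u_i, v_j)_s
   over all sequences u and v converging to p and q. *)
Definition gromov_prod_ext (p q : bordification) s : \bar R :=
  ereal_sup [set limf_einf
                   (fun ij : nat * nat =>
                      (gromov_prod (uv.1 ij.1) (uv.2 ij.2) s)%:E)
                   (filter_prod \oo \oo)
            | uv in [set uv : (nat -> S) * (nat -> S) |
                      approximates uv.1 p /\ approximates uv.2 q]].

(* A set is open when its trace on [S] is open for the metric and, with each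
   boundary point xi, it contains {q | (xi, q)_s > r} for some r; this does not
   depend on the base point s. *)
Definition bordification_open (U : set bordification) : Prop :=
  open [set x : S | U (inl x)] /\
  forall xi : gromov_boundary, U (inr xi) ->
    forall s, exists r : R,
      [set q | (r%:E < gromov_prod_ext (inr xi) q s)%E] `<=` U.

Lemma bordification_openT : bordification_open setT.
Proof.
split; first exact: openT.
by move=> xi _ s; exists 0 => q.
Qed.

Lemma bordification_openI : setI_closed bordification_open.
Proof.
move=> U V [oU bU] [oV bV]; split; first exact: openI.
move=> xi [Uxi Vxi] s.
have [r rU] := bU _ Uxi s; have [t tV] := bV _ Vxi s.
exists (Num.max r t) => q /= rtq; split.
  by apply: rU; apply: le_lt_trans rtq; rewrite lee_fin le_max lexx.
by apply: tV; apply: le_lt_trans rtq; rewrite lee_fin le_max lexx orbT.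
Qed.

Lemma bordification_open_bigU (I : Type) (f : I -> set bordification) :
  (forall i, bordification_open (f i)) ->
  bordification_open (\bigcup_i f i).
Proof.
move=> of_; split.
  rewrite (_ : mkset _ = \bigcup_i [set x : S | f i (inl x)]) //.
  by apply: bigcup_open => i _; case: (of_ i).
move=> xi [i _ fxi] s; have [_ /(_ _ fxi s)[r rf]] := of_ i.
by exists r => q /rf fq; exists i.
Qed.

HB.instance Definition _ := Choice.on bordification.
HB.instance Definition _ := isOpenTopological.Build bordification
  bordification_openT bordification_openI bordification_open_bigU.

Lemma boundary_act_subproof (g : isom S) (xi : gromov_boundary) :
  [set (g : S -> S) \o u | u in val xi] \in gromov_boundary.
Proof.
have prodE h x y s :
    gromov_prod ((h : isom S) x) (h y) (h s) = gromov_prod x y s.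
  by rewrite /gromov_prod !isom_dist.
have divE (h : isom S) u v : gromov_diverge u v ->
    gromov_diverge ((h : S -> S) \o u) ((h : S -> S) \o v).
  case=> s uvs; exists (h s); apply: cvg_trans uvs.
  by apply: near_eq_cvg; near=> ij; rewrite /= prodE.
have /set_mem[u uoo <-] := valP xi.
apply/mem_set; exists ((g : S -> S) \o u); first exact: divE.
apply/seteqP; split=> [v [voo uv]|_ [v [voo uv] <-]]; last first.
  by split; exact: divE.
exists ((isom_inv g : S -> S) \o v).
  split; first exact: divE.
  have := divE (isom_inv g) _ _ uv.
  by rewrite (_ : _ \o (_ \o u) = u)//; apply/funext => i /=; rewrite isom_invK.
by apply/funext => i /=; rewrite isom_invKV.
Unshelve. all: by end_near. Qed.

Definition boundary_act (g : isom S) (xi : gromov_boundary) : gromov_boundary :=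
  SigSub (boundary_act_subproof g xi).

(* The closure does not depend on the choice of s. *)
Definition limit_set (G : set (isom S)) : set gromov_boundary :=
  [set xi | exists s : S,
     closure (inl @` orbit_of G s : set bordification) (inr xi)].

Definition non_elementary (G : set (isom S)) : Prop :=
  (`I_3 #<= limit_set G)%card.

Definition general_type (G : set (isom S)) : Prop :=
  non_elementary G /\
  ~ exists xi : gromov_boundary, forall g, G g -> boundary_act g xi = xi.

End Hyperbolic.

Arguments gromov_boundary {R} S.

(* Main.v *)
(* Suppose that an orbit of the Frattini subgroup Phi is unbounded. If Phi had no
   loxodromic element, all its far orbit points would lie in the same direction,
   and since Phi is normal G would fix the resulting boundary point. So Phi
   contains a loxodromic t, with ends p and q. As G is of general type, it has an
   element k with {kp, kq} disjoint from {p, q}, and the elements g_0, g_1, ... of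
   this kind generate G: for large n both t^n k and x t^n k are among them. For a
   sparse sequence of exponents n_i, the elements h_i = t^{n_i} g_i t^{n_i} play
   ping-pong on the sets of points whose projection to the axis of t is near
   t^{n_i} s or t^{-n_i} s, and t s lies outside these sets, so t is not in
   H = <h_0, h_1, ...>. But t and H generate G and t, being in Phi, is a
   non-generator, which forces t to be in H. *)

Require Import Defs.
From mathcomp Require Import all_boot all_order all_algebra.
From mathcomp Require Import all_classical all_reals all_analysis.
From mathcomp Require Import zify lra.

Set Implicit Arguments.
Unset Strict Implicit.
Unset Printing Implicit Defensive.

Import Order.TTheory GRing.Theory Num.Theory.

Local Open Scope classical_set_scope.
Local Open Scope ring_scope.

(** * Frattini subgroup *)

Section GroupTheory.
Context (T : groupType).
Implicit Types (G H K M A : set T) (x y t : T).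

Lemma subgroupP G :
  subgroup G <-> [/\ G 1%g, (forall x y, G x -> G y -> G (x * y)%g)
                   & forall x, G x -> G x^-1%g].
Proof.
split=> [GG|[G1 GM GV]].
  split; first by have [/set_mem] := GG.
  - by move=> x y /mem_set Gx /mem_set Gy; apply/set_mem/(group_closedM GG).
  - by move=> x /mem_set Gx; apply/set_mem/(group_closedV GG).
split; first exact: mem_set.
by move=> x y /set_mem Gx /set_mem Gy; apply/mem_set/GM/GV.
Qed.

Lemma subgroup1 G : subgroup G -> G 1%g.
Proof. by move=> /subgroupP[]. Qed.

Lemma subgroupM G x y : subgroup G -> G x -> G y -> G (x * y)%g.
Proof. by move=> /subgroupP[_ + _]; apply. Qed.

Lemma subgroupV G x : subgroup G -> G x -> G x^-1%g.
Proof. by move=> /subgroupP[_ _]; apply. Qed.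

Lemma subgroupX G x n : subgroup G -> G x -> G (x ^+ n)%g.
Proof.
move=> GG Gx; elim: n => [|n IHn]; first exact: subgroup1.
by rewrite expgS; apply: subgroupM.
Qed.

Lemma subgroup_bigcap (I : Type) (P : set I) (F : I -> set T) :
  (forall i, P i -> subgroup (F i)) -> subgroup (\bigcap_(i in P) F i).
Proof.
move=> sF; apply/subgroupP; split.
- by move=> i /sF; exact: subgroup1.
- by move=> x y Fx Fy i Pi; apply: subgroupM (sF _ Pi) (Fx _ Pi) (Fy _ Pi).
- by move=> x Fx i Pi; apply: subgroupV (sF _ Pi) (Fx _ Pi).
Qed.

Lemma subgroupI G H : subgroup G -> subgroup H -> subgroup (G `&` H).
Proof.
move=> sG sH; apply/subgroupP; split.
- by split; exact: subgroup1.
- by move=> x y [Gx Hx] [Gy Hy]; split; exact: subgroupM.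
- by move=> x [Gx Hx]; split; exact: subgroupV.
Qed.

Definition generated A : set T :=
  \bigcap_(K in [set K | subgroup K /\ A `<=` K]) K.

Lemma subgroup_generated A : subgroup (generated A).
Proof. by apply: (@subgroup_bigcap _ _ id) => K []. Qed.

Lemma sub_generated A : A `<=` generated A.
Proof. by move=> x Ax K [_]; apply. Qed.

Lemma generated_min A K : subgroup K -> A `<=` K -> generated A `<=` K.
Proof. by move=> sK AK x; apply; split. Qed.

Lemma frattini_sub G : frattini G `<=` G.
Proof. by move=> x []. Qed.

Lemma subgroup_frattini G : subgroup G -> subgroup (frattini G).
Proof.
move=> sG; rewrite /frattini; apply: subgroupI => //.
by apply: (@subgroup_bigcap _ _ id) => M [].
Qed.

(** This is the conjugate [x H x^-1], written as a preimage so that membership is membership in [H]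
    by computation. *)
Definition conj_preimage H x : set T := [set y | H (x^-1 * y * x)%g].

Lemma subgroup_conj H x : subgroup H -> subgroup (conj_preimage H x).
Proof.
move=> sH; apply/subgroupP; split; rewrite /conj_preimage /=.
- by rewrite mulg1 mulVg; exact: subgroup1.
- move=> y z Hy Hz; have := subgroupM sH Hy Hz.
  by rewrite -!mulgA (mulgA x) mulgV mul1g.
- by move=> y /(subgroupV sH); rewrite !invgM invgK !mulgA.
Qed.

Lemma conj_preimageK H x : conj_preimage (conj_preimage H x) x^-1%g = H.
Proof.
apply/funext => y; rewrite /conj_preimage/= invgK !mulgA mulVg mul1g.
by rewrite -mulgA mulVg mulg1.
Qed.

Lemma conj_preimageKV H x : conj_preimage (conj_preimage H x^-1%g) x = H.
Proof. by have := conj_preimageK H x^-1%g; rewrite invgK. Qed.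

Lemma conj_preimageS H K x :
  H `<=` K -> conj_preimage H x `<=` conj_preimage K x.
Proof. by move=> HK y; exact: HK. Qed.

Lemma conj_preimage_id G x : subgroup G -> G x -> conj_preimage G x = G.
Proof.
move=> sG; suff H y : G y -> conj_preimage G y `<=` G.
  move=> Gx; apply/seteqP; split; first exact: H.
  have /(@conj_preimageS _ _ x) := H _ (subgroupV sG Gx).
  by rewrite conj_preimageKV.
move=> Gy z Gz; have := subgroupM sG (subgroupM sG Gy Gz) (subgroupV sG Gy).
by rewrite !mulgA mulgV mul1g -mulgA mulgV mulg1.
Qed.

Lemma maximal_subgroup_conj G M x : subgroup G -> G x ->
  maximal_subgroup G M -> maximal_subgroup G (conj_preimage M x).
Proof.
move=> sG Gx [sM [MG GM] maxM].
have Gx' : G x^-1%g by exact: subgroupV.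
split; first exact: subgroup_conj.
  split; last first.
    move=> /(@conj_preimageS _ _ x^-1%g).
    by rewrite conj_preimageK conj_preimage_id.
  by rewrite -[X in _ `<=` X](conj_preimage_id sG Gx); exact: conj_preimageS.
move=> H sH MH HG.
have [||HM|HG'] := maxM _ (subgroup_conj x^-1%g sH).
- by rewrite -[X in X `<=` _](conj_preimageK M x); exact: conj_preimageS.
- by rewrite -(conj_preimage_id sG Gx'); exact: conj_preimageS.
- by left; rewrite -HM conj_preimageKV.
- by right; rewrite -(conj_preimageKV H x) HG' conj_preimage_id.
Qed.

(** Conjugation by an element of [G] permutes the maximal subgroups of [G], hence preserves their
    intersection. *)
Lemma frattini_conj G x y : subgroup G -> G x -> frattini G y ->
  frattini G (x * y * x^-1)%g.
Proof.
move=> sG Gx [Gy My]; split.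
  by apply: subgroupM; [|exact: subgroupM|exact: subgroupV].
move=> M maxM.
have := My _ (maximal_subgroup_conj sG (subgroupV sG Gx) maxM).
by rewrite /conj_preimage /= invgK.
Qed.

(* If [t] were not in [H], a subgroup maximal among those that contain [H] and
   avoid [t] would be a maximal subgroup of [G]. *)
Lemma frattini_nongenerator G H t : subgroup G -> subgroup H -> H `<=` G ->
  (forall K, subgroup K -> K `<=` G -> H `<=` K -> K t -> K = G) ->
  frattini G t -> H t.
Proof.
move=> sG sH HG genH [Gt maxt]; apply: contrapT => nHt.
pose P A := A = set0 \/ [/\ subgroup A, H `<=` A, A `<=` G & ~ A t].
have [|A [PA maxA]] := @Zorn_bigcup _ P.
  move=> F FP totF; have [[A [FA A0]]|F0] :=
      pselect (exists A, F A /\ A <> set0); last first.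
    left; apply/seteqP; split => // x [A FA Ax]; apply: F0; exists A.
    by split=> // A0; rewrite A0 in Ax.
  right; have FP' B x : F B -> B x ->
      [/\ subgroup B, H `<=` B, B `<=` G & ~ B t].
    by move=> /FP[->//|].
  have [x Ax] : exists x, A x.
    by apply: contrapT => nA; apply: A0; apply/seteqP; split=> // x Ax;
       apply: nA; exists x.
  have [sA HA AG nAt] := FP' _ _ FA Ax.
  split.
  - apply/subgroupP; split; first by exists A => //; exact: subgroup1.
    + move=> y z [B FB By] [C FC Cz].
      have [sB _ _ _] := FP' _ _ FB By; have [sC _ _ _] := FP' _ _ FC Cz.
      have [BC|CB] := totF _ _ FB FC.
        by exists C => //; apply: subgroupM => //; exact: BC.
      by exists B => //; apply: subgroupM => //; exact: CB.
    + move=> y [B FB By]; have [sB _ _ _] := FP' _ _ FB By.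
      by exists B => //; exact: subgroupV.
  - by move=> y Hy; exists A => //; exact: HA.
  - by move=> y [B FB By]; have [_ _ + _] := FP' _ _ FB By; apply.
  - by move=> [B FB Bt]; have [_ _ _] := FP' _ _ FB Bt.
have {PA} [sA HA AG nAt] : [/\ subgroup A, H `<=` A, A `<=` G & ~ A t].
  case: PA => // A0; exfalso; apply: (maxA H); last by right; split.
  by rewrite A0; split => // H0; exact: (H0 1%g (subgroup1 sH)).
(* It remains to see that [A] is maximal in [G]: a subgroup above [A] either contains [t], and is
   [G] by hypothesis, or avoids [t], and is [A] by the choice of [A]. *)
apply: (nAt); apply: maxt; split=> //; first by split=> // GA; exact/nAt/GA.
move=> K sK AK KG; have [Kt|nKt] := pselect (K t).
  by right; apply: genH => //; exact: subset_trans AK.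
left; apply/seteqP; split=> //; apply: contrapT => nKA.
by apply: (maxA K); [split|right; split=> //; exact: subset_trans AK].
Qed.

End GroupTheory.

(** * Ping-pong *)

Section PingPong.
Context (T : groupType) (X : Type) (act : T -> X -> X).
Context (L : Type) (inv : L -> L) (h : L -> T) (U : L -> set X) (x0 : X).
Context (actM : forall g k x, act (g * k)%g x = act g (act k x)).
Context (hV : forall a, h (inv a) = (h a)^-1%g).
Context (actU0 : forall a, U a (act (h a) x0)).
Context (actU : forall a b x, b <> inv a -> U b x -> U a (act (h a) x)).

(* [reduced o g]: [g] is the value of a reduced word, whose first letter is
   [a] if [o = Some a] and which is empty if [o = None]. *)
Inductive reduced : option L -> T -> Prop :=
| reduced_nil : reduced None 1%g
| reduced_cons o a g :
    reduced o g -> o <> Some (inv a) -> reduced (Some a) (h a * g)%g.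

Lemma reduced_mul a o g : reduced o g -> exists o', reduced o' (h a * g)%g.
Proof.
move=> rg; have [oa|oa] := pselect (o = Some (inv a)); last first.
  by exists (Some a); exact: (reduced_cons rg oa).
case: rg oa => // o' b {}g rg _ [->]; exists o'.
by rewrite hV mulgA mulgV mul1g.
Qed.

(** The last letter moves [x0] into its own region. Every letter to its left moves the region of its
    successor into its own, since neighbouring letters are not inverse to each other. *)
Lemma reduced_ping_pong o g : reduced o g ->
  if o is Some a then U a (act g x0) else g = 1%g.
Proof.
elim=> // {}o a {}g _ IH oa; rewrite actM; case: o oa IH => [b|] oa; last first.
  by move=> eg; rewrite eg -actM mulg1; exact: actU0.
by apply: actU => ba; apply: oa; rewrite ba.
Qed.

Lemma ping_pong g :
  generated (range h) g -> g = 1%g \/ exists a, U a (act g x0).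
Proof.
pose W k := exists o, reduced o k.
have hW a k : W k -> W (h a * k)%g by case=> u /(reduced_mul a).
(* Asking both [x] and its inverse to preserve values of reduced words makes [K] a subgroup; it
   contains the letters, and its action on the empty word shows that each of its elements is such a
   value. *)
pose K : set T := [set x | forall k, W k -> W (x * k)%g /\ W (x^-1 * k)%g].
have sK : subgroup K.
  apply/subgroupP; split.
  - by move=> k Wk; rewrite invg1 mul1g.
  - move=> x y Kx Ky k Wk; rewrite invgM -!mulgA.
    by split; [apply/(Kx _ _).1/(Ky _ _).1|apply/(Ky _ _).2/(Kx _ _).2].
  - by move=> x Kx k /Kx[]; rewrite invgK.
have hK : range h `<=` K.
  by move=> _ [a _ <-] k Wk; split; [|rewrite -hV]; exact: hW.
move=> /(generated_min sK hK)/(_ 1%g)[|]; first by exists None; constructor.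
move=> + _; rewrite mulg1; case=> [ [a|] /reduced_ping_pong]; last by left.
by right; exists a.
Qed.

End PingPong.

(** * Integer powers in a group *)

Section IntegerPower.
Context (T : groupType).
Implicit Types (t : T) (m n : int).

Definition zpow t m : T :=
  match m with Posz n => (t ^+ n)%g | Negz n => (t ^- n.+1)%g end.

Lemma zpowN t m : zpow t (- m) = (zpow t m)^-1%g.
Proof.
case: m => [[|n]|n]; rewrite ?oppr0 /= ?expg0 ?invg1 //.
by rewrite invgK.
Qed.

Lemma zpowS t m : zpow t (m + 1) = (zpow t m * t)%g.
Proof.
case: m => n; first by rewrite -[n%:Z + 1]PoszD addn1 /= expgSr.
have -> : Negz n + 1 = - n%:Z by lia.
by rewrite zpowN /= expgS invgM -mulgA mulVg mulg1.
Qed.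

Lemma zpowD t m n : zpow t (m + n) = (zpow t m * zpow t n)%g.
Proof.
elim: n m => [m|n IHn m|n IHn m]; first by rewrite addr0 mulg1.
  by rewrite -addn1 PoszD addrA !zpowS IHn mulgA.
have -> : - Posz n.+1 = - n%:Z - 1 by lia.
rewrite addrA.
apply: (mulIg t); rewrite -zpowS subrK -mulgA -zpowS subrK; exact: IHn.
Qed.

Lemma subgroup_zpow (G : set T) t m : subgroup G -> G t -> G (zpow t m).
Proof.
by move=> sG Gt; case: m => n /=; [|apply: subgroupV => //]; exact: subgroupX.
Qed.

End IntegerPower.

(** * Gromov products and loxodromic isometries *)

Section GromovProduct.
Context (R : realType) (S : metricType R).
Implicit Types (x y z s : S) (g h : isom S).

Lemma isom_mulE g h x : (g * h)%g x = g (h x).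
Proof. by []. Qed.

Lemma isom_1E x : (1%g : isom S) x = x.
Proof. by []. Qed.

Lemma isom_KV g x : g ((g^-1)%g x) = x.
Proof. exact: isom_invKV. Qed.

Definition displacement s g : R := mdist s (g s).

Lemma displacement_ge0 s g : 0 <= displacement s g.
Proof. exact: mdist_ge0. Qed.

Lemma displacementV s g : displacement s g^-1%g = displacement s g.
Proof. by rewrite /displacement -(isom_dist g) isom_KV metric_sym. Qed.

Lemma displacementM s g h :
  displacement s (g * h)%g <= displacement s g + displacement s h.
Proof.
rewrite /displacement isom_mulE (le_trans (metric_triangle _ (g s) _))//.
by rewrite isom_dist.
Qed.

Lemma gromov_prod_sym x y s : gromov_prod x y s = gromov_prod y x s.
Proof. by rewrite /gromov_prod (metric_sym x y) [X in X - _]addrC. Qed.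

Lemma gromov_prod_isom g x y s :
  gromov_prod (g x) (g y) (g s) = gromov_prod x y s.
Proof. by rewrite /gromov_prod !isom_dist. Qed.

Lemma gromov_prod_isomV g x y s :
  gromov_prod (g x) y s = gromov_prod x (g^-1%g y) (g^-1%g s).
Proof. by rewrite -(gromov_prod_isom g x) !isom_KV. Qed.

Lemma gromov_prod_ge0 x y s : 0 <= gromov_prod x y s.
Proof.
rewrite /gromov_prod; have := metric_triangle x s y.
rewrite (metric_sym s y); lra.
Qed.

Lemma gromov_prod_base s x : gromov_prod s x s = 0.
Proof. by rewrite /gromov_prod mdistxx (metric_sym x s); lra. Qed.

Lemma gromov_prod_le x y s : gromov_prod x y s <= mdist s y.
Proof.
rewrite /gromov_prod; have := metric_triangle x y s.
rewrite (metric_sym s y); lra.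
Qed.

Lemma gromov_prod_diag x s : gromov_prod x x s = mdist s x.
Proof. by rewrite /gromov_prod mdistxx (metric_sym s x); lra. Qed.

Lemma gromov_prod_lip x x' y s :
  gromov_prod x y s <= gromov_prod x' y s + mdist x x'.
Proof.
rewrite /gromov_prod; have := metric_triangle x x' s.
have := metric_triangle x' x y; rewrite (metric_sym x' x); lra.
Qed.

Lemma gromov_prod_lip_base x y s s' :
  gromov_prod x y s <= gromov_prod x y s' + mdist s s'.
Proof.
rewrite /gromov_prod; have := metric_triangle x s' s.
by have := metric_triangle y s' s; rewrite (metric_sym s' s); lra.
Qed.

(** After translation by [g] the second product is that of [g x] and [s] based at [g s]; the two
    products at the ends of the side from [s] to [g s] add up to its length. *)
Lemma gromov_prod_shift g x s :
  gromov_prod (g x) (g s) s + gromov_prod x (g^-1%g s) s = displacement s g.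
Proof.
rewrite /gromov_prod /displacement !isom_dist.
rewrite -(isom_dist g x (g^-1%g s)) -(isom_dist g (g^-1%g s) s) isom_KV.
by rewrite (metric_sym (g s) s); lra.
Qed.

Definition delta_hyperbolic (d : R) : Prop :=
  0 <= d /\ forall r x y z s,
    r <= gromov_prod x y s -> r <= gromov_prod y z s ->
    r - d <= gromov_prod x z s.

Lemma hyperbolicP : hyperbolic S -> exists d, delta_hyperbolic d.
Proof.
move=> [d hd]; exists `|d|; split=> // r x y z s rxy ryz.
apply: le_trans (hd x y z s); apply: lerB; last exact: ler_norm.
by rewrite le_min rxy.
Qed.

End GromovProduct.

(** * Linear growth along the orbit of a loxodromic isometry *)

Section Loxodromic.
Context (R : realType) (S : metricType R) (d : R) (s : S).
Context (hypS : delta_hyperbolic S d).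
Implicit Types (x y z : S) (g h t : isom S).

Local Notation gp x y := (gromov_prod x y s).
Local Notation len g := (displacement s g).

(* A local condition on three consecutive points of the orbit of [t] which
   forces the whole orbit to be a quasi-geodesic. *)
Definition loxodromic t : Prop := 2 * gp (t s) (t^-1%g s) + 4 * d < len t.

Let d_ge0 : 0 <= d. Proof. by case: hypS. Qed.

Lemma hyp_le r x y z : r <= gp x y -> r <= gp y z -> r - d <= gp x z.
Proof. by case: hypS => _; apply. Qed.

Lemma hyp_gt r x y z : r < gp x y -> r < gp y z -> r - d < gp x z.
Proof.
move=> rxy ryz; pose m := Num.min (gp x y) (gp y z).
have /lt_le_trans : r - d < m - d by rewrite ltrD2r lt_min rxy.
by apply; apply: (hyp_le (y := y)); rewrite ge_min lexx ?orbT.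
Qed.

Lemma hyp_lt r x y z : r <= gp x y -> gp x z < r - d -> gp y z < r.
Proof. by move=> rxy; apply: contraTT; rewrite -!leNgt => /(hyp_le rxy). Qed.

Lemma loxodromicV t : loxodromic t -> loxodromic t^-1%g.
Proof.
by rewrite /loxodromic displacementV invgK gromov_prod_sym.
Qed.

Definition lox_gap t : R := gp (t s) (t^-1%g s) + 2 * d.

(** By induction and [gromov_prod_shift], [t^(n+1) s] lies in nearly the same direction as [t s]; a
    large product with [t^-1 s] would then make the product of [t s] and [t^-1 s] too large. *)
Lemma lox_one_side t n : loxodromic t ->
  gp ((t ^+ n)%g s) (t^-1%g s) <= gp (t s) (t^-1%g s) + d.
Proof.
rewrite /loxodromic => ht; elim: n => [|n IHn].
  rewrite expg0 isom_1E gromov_prod_base addr_ge0//.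
  exact: gromov_prod_ge0.
have := gromov_prod_shift t ((t ^+ n)%g s) s.
rewrite -isom_mulE -expgS => e.
rewrite leNgt; apply/negP => lt.
have lt' : gp (t s) (t^-1%g s) + d < gp (t s) ((t ^+ n.+1)%g s).
  by rewrite [ltRHS]gromov_prod_sym; have := d_ge0; lra.
by have := hyp_gt lt' lt; lra.
Qed.

(** On the negative side [t^-(j+1) s] lies in the direction of [t^-1 s], which reduces the claim to
    [lox_one_side] at the cost of the second [d] in [lox_gap]. *)
Lemma lox_two_sides t i j : loxodromic t ->
  gp ((t ^+ i)%g s) ((t ^- j)%g s) <= lox_gap t.
Proof.
move=> ht; have := ht; rewrite /loxodromic /lox_gap.
have := d_ge0; have a0 := gromov_prod_ge0 (t s) (t^-1%g s) s.
case: j => [|j] d0 ht'.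
  rewrite expg0 invg1 isom_1E gromov_prod_sym gromov_prod_base; lra.
have i1 := lox_one_side i ht; rewrite leNgt; apply/negP => lt.
have lt' : gp (t s) (t^-1%g s) + 2 * d < gp ((t ^- j.+1)%g s) (t^-1%g s).
  have := gromov_prod_shift t^-1%g ((t ^- j)%g s) s.
  rewrite -isom_mulE -invgM -expgSr invgK displacementV.
  have := lox_one_side j (loxodromicV ht).
  rewrite invgK expVgn (gromov_prod_sym (t^-1%g s) (t s)); lra.
by have := hyp_gt lt lt'; lra.
Qed.

(** The length of [t^(i+j)] is the distance from [t^i s] to [t^-j s], and [lox_two_sides] bounds the
    backtracking of that path at [s]. *)
Lemma len_expD t i j : loxodromic t ->
  len (t ^+ i)%g + len (t ^+ j)%g - 2 * lox_gap t <= len (t ^+ (i + j))%g.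
Proof.
move=> /(lox_two_sides i j); rewrite /gromov_prod.
suff -> : mdist ((t ^+ i)%g s) ((t ^- j)%g s) = len (t ^+ (i + j))%g.
  rewrite -[in len (t ^+ j)%g](displacementV s (t ^+ j)%g) /displacement.
  by rewrite !(metric_sym _ s); lra.
rewrite -(isom_dist (t ^+ j)%g) isom_KV metric_sym -isom_mulE -expgnDr.
by rewrite addnC.
Qed.

Definition lox_rate t : R := len t - 2 * lox_gap t.

Lemma lox_rate_gt0 t : loxodromic t -> 0 < lox_rate t.
Proof. by rewrite /lox_rate /loxodromic /lox_gap; lra. Qed.

Lemma len_exp t n : loxodromic t -> n%:R * lox_rate t <= len (t ^+ n)%g.
Proof.
move=> ht; elim: n => [|n IHn]; first by rewrite mul0r displacement_ge0.
have := len_expD n 1 ht; rewrite addn1 expg1 -natr1 mulrDl mul1r.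
by rewrite /lox_rate in IHn *; lra.
Qed.

Lemma len_zpow t m : loxodromic t -> `|m|%:~R * lox_rate t <= len (zpow t m).
Proof.
move=> ht; case: m => n /=; first exact: len_exp.
by rewrite displacementV; exact: len_exp.
Qed.

(** Shifting by [t^i] turns this into the bound of [lox_two_sides] on the product of [t^(j-i) s] and
    [t^-i s]. *)
Lemma lox_same_side t i j : loxodromic t -> (i <= j)%N ->
  len (t ^+ i)%g - lox_gap t <= gp ((t ^+ i)%g s) ((t ^+ j)%g s).
Proof.
move=> ht ij; have := gromov_prod_shift (t ^+ i)%g ((t ^+ (j - i))%g s) s.
rewrite -isom_mulE -expgnDr subnKC// gromov_prod_sym.
by have := lox_two_sides (j - i) i ht; lra.
Qed.

End Loxodromic.

(** * Boundary *)

Section Boundary.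
Context (R : realType) (S : metricType R) (d : R) (s : S).
Context (hypS : delta_hyperbolic S d).
Implicit Types (x y z : S) (g h t : isom S) (u v w : nat -> S).
Implicit Types xi eta : gromov_boundary S.

Local Notation gp x y := (gromov_prod x y s).
Local Notation len g := (displacement s g).

Lemma gromov_divergeP u v : gromov_diverge u v <->
  forall r, exists N, forall i j, (N <= i)%N -> (N <= j)%N -> r <= gp (u i) (v j).
Proof.
split=> [[s' /cvgryPge uv] r|uv].
  have [[A B] /= [[N _ NA] [M _ MB]] AB] := uv (r + mdist s' s).
  exists (maxn N M) => i j; rewrite !geq_max => /andP[Ni _] /andP[_ Mj].
  have /= := AB (i, j) (conj (NA _ Ni) (MB _ Mj)).
  by have := gromov_prod_lip_base (u i) (v j) s' s; lra.
exists s; apply/cvgryPge => r; have [N uvN] := uv r.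
exists ([set i | (N <= i)%N], [set j | (N <= j)%N]) => /=.
  by split; exists N.
by move=> [i j] /= [Ni Nj]; exact: uvN.
Qed.

Lemma gromov_diverge_sym u v : gromov_diverge u v -> gromov_diverge v u.
Proof.
move=> /gromov_divergeP uv; apply/gromov_divergeP => r.
have [N uvN] := uv r; exists N => i j Ni Nj.
by rewrite gromov_prod_sym; exact: uvN.
Qed.

Lemma gromov_diverge_trans u v w :
  gromov_diverge u v -> gromov_diverge v w -> gromov_diverge u w.
Proof.
move=> /gromov_divergeP uv /gromov_divergeP vw; apply/gromov_divergeP => r.
have [N uvN] := uv (r + d); have [M vwM] := vw (r + d).
exists (maxn N M) => i j; rewrite !geq_max => /andP[Ni Mi] /andP[Nj Mj].
rewrite -[r](addrK d); apply: (hyp_le hypS (y := v (maxn N M))).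
  by apply: uvN => //; exact: leq_maxl.
by apply: vwM => //; exact: leq_maxr.
Qed.

Lemma gromov_diverge_isom g u v :
  gromov_diverge u v -> gromov_diverge (g \o u) (g \o v).
Proof.
move=> /gromov_divergeP uv; apply/gromov_divergeP => r.
have [N uvN] := uv (r + mdist (g s) s); exists N => i j Ni Nj /=.
have := uvN _ _ Ni Nj; rewrite -(gromov_prod_isom g).
by have := gromov_prod_lip_base (g (u i)) (g (v j)) (g s) s; lra.
Qed.

Lemma boundary_ex xi : exists u, val xi u.
Proof.
have /set_mem[u uoo <-] := valP xi; exists u; split=> //; exact: uoo.
Qed.

Lemma boundary_converges xi u : val xi u -> converges_at_infinity u.
Proof. by have /set_mem[w _ <-] := valP xi; case. Qed.

Lemma boundary_eqP xi eta u v :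
  val xi u -> val eta v -> xi = eta <-> gromov_diverge u v.
Proof.
have /set_mem[a _ xia] := valP xi; have /set_mem[b _ etab] := valP eta.
rewrite -xia -etab => -[_ au] [_ bv]; split=> [xe|uv].
  apply: gromov_diverge_trans bv.
  have : boundary_class b u by rewrite etab -xe -xia; split=> //;
    exact: gromov_diverge_trans (gromov_diverge_sym au) au.
  by case=> _ /gromov_diverge_sym.
apply: val_inj; rewrite -xia -etab.
have ab : gromov_diverge a b.
  apply: gromov_diverge_trans au _; apply: gromov_diverge_trans uv _.
  exact: gromov_diverge_sym.
apply/seteqP; split=> w [ww aw]; split=> //.
  exact: gromov_diverge_trans (gromov_diverge_sym ab) aw.
exact: gromov_diverge_trans ab aw.
Qed.

Lemma boundary_actE g xi u : val xi u -> val (boundary_act g xi) (g \o u).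
Proof. by move=> xiu; exists u. Qed.

Lemma boundary_actM g h xi :
  boundary_act (g * h)%g xi = boundary_act g (boundary_act h xi).
Proof.
have [u xiu] := boundary_ex xi.
apply/(boundary_eqP (boundary_actE _ xiu) (boundary_actE _ (boundary_actE _ xiu))).
by apply/gromov_diverge_isom/(boundary_converges xiu).
Qed.

Lemma boundary_act1 xi : boundary_act 1%g xi = xi.
Proof.
have [u xiu] := boundary_ex xi.
apply/(boundary_eqP (boundary_actE _ xiu) xiu).
exact: boundary_converges xiu.
Qed.

Lemma boundary_actK g xi : boundary_act g^-1%g (boundary_act g xi) = xi.
Proof. by rewrite -boundary_actM mulVg boundary_act1. Qed.

Lemma boundary_actKV g xi : boundary_act g (boundary_act g^-1%g xi) = xi.
Proof. by rewrite -boundary_actM mulgV boundary_act1. Qed.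

Definition boundary_point u (cu : converges_at_infinity u) :
    gromov_boundary S :=
  SigSub (mem_set (ex_intro2 _ _ u cu erefl :
    gromov_boundary S (boundary_class u))).

Lemma boundary_pointE u (cu : converges_at_infinity u) :
  val (boundary_point cu) u.
Proof. by []. Qed.

End Boundary.

(** * Loxodromic elements in unbounded normal subgroups *)

Section UnboundedNormal.
Context (R : realType) (S : metricType R) (d : R) (s : S).
Context (hypS : delta_hyperbolic S d).
Implicit Types (x y z : S) (g h k t : isom S) (G N : set (isom S)).

Local Notation gp x y := (gromov_prod x y s).
Local Notation len g := (displacement s g).

(* If the orbit points [g s] and [h s] diverged early, [g * h] would satisfy
   the criterion [loxodromic]. *)
Lemma no_loxodromic_gromov_prod N L g h : subgroup N ->
  (forall t, N t -> ~ loxodromic d s t) -> N g -> N h ->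
  L <= len g -> L <= len h -> L / 2 - 3 * d <= gp (g s) (h s).
Proof.
move=> sN nolox Ng Nh Lg Lh; have [d0 _] := hypS.
(* A non-loxodromic element sends [s] forwards and backwards in nearly the same direction, up to
   about half its length. *)
have gg : len g / 2 - 2 * d <= gp (g s) (g^-1%g s).
  by have /negP := nolox _ Ng; rewrite -leNgt; lra.
have hh : len h / 2 - 2 * d <= gp (h s) (h^-1%g s).
  by have /negP := nolox _ Nh; rewrite -leNgt; lra.
rewrite leNgt; apply/negP => lt.
have lt1 : gp (g^-1%g s) (h s) < L / 2 - 2 * d.
  apply: (hyp_lt hypS (x := g s)); lra.
have lt2 : gp (h^-1%g s) (g s) < L / 2 - 2 * d.
  by apply: (hyp_lt hypS (x := h s)); [lra | rewrite gromov_prod_sym; lra].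
have e1 := gromov_prod_shift g (h s) s.
have e2 := gromov_prod_shift h^-1%g (g^-1%g s) s.
rewrite invgK displacementV -!isom_mulE -invgM in e1 e2.
have lt1' : gp (h s) (g^-1%g s) < L / 2 - 2 * d by rewrite gromov_prod_sym.
have lt3 : gp ((g * h)^-1%g s) (g s) < L / 2 - d.
  apply: (hyp_lt hypS (x := h^-1%g s)); last by lra.
  by rewrite gromov_prod_sym; lra.
have lt4 : gp ((g * h)%g s) ((g * h)^-1%g s) < L / 2.
  apply: (hyp_lt hypS (x := g s)); rewrite gromov_prod_sym; lra.
apply: (nolox _ (subgroupM sN Ng Nh)); rewrite /loxodromic.
have -> : len (g * h)%g = len g + len h - 2 * gp (g^-1%g s) (h s).
  rewrite -(displacementV s g) /displacement /gromov_prod.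
  by rewrite -(isom_dist g (g^-1%g s) (h s)) isom_KV !(metric_sym _ s); lra.
lra.
Qed.

(** Without loxodromic elements, orbit points [a n s] with [a n] in [N] going far away converge at
    infinity. For [k] in [G], [k (a n s)] stays within [len k] of the orbit point of a conjugate of
    [a n], again in [N], so [k] fixes the limit. *)
Lemma unbounded_normal_loxodromic G N :
  subgroup G -> subgroup N -> N `<=` G ->
  (forall g h, G g -> N h -> N (g * h * g^-1)%g) ->
  (forall r, exists2 g, N g & r <= len g) ->
  (~ exists xi : gromov_boundary S, forall g, G g -> boundary_act g xi = xi) ->
  exists2 t, N t & loxodromic d s t.
Proof.
move=> sG sN NG normN unbN nofix; apply: contrapT => nolox'.
have nolox t : N t -> ~ loxodromic d s t.
  by move=> Nt lt; apply: nolox'; exists t.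
have /choice[a aP] : forall n : nat, exists g, N g /\ n%:R <= len g.
  by move=> n; have [g] := unbN n%:R; exists g.
pose u n := a n s.
have uk k : G k -> gromov_diverge (k \o u) u.
  move=> Gk; apply/(gromov_divergeP s) => r.
  (* Chosen so that [m / 2 - 3 * d = r + len k]; the term [len k] pays for replacing [k a k^-1 s] by
     [k a s]. Conjugation shortens [a i] by at most [2 * len k], whence the threshold below. *)
  pose m := 2 * (r + len k + 3 * d).
  exists (Num.truncn (`|m| + 2 * len k)).+1 => i j mi mj.
  have leN (n : nat) : ((Num.truncn (`|m| + 2 * len k)).+1 <= n)%N ->
      m + 2 * len k <= n%:R.
    move=> mn; have := ler_norm m; have : (`|m| + 2 * len k) <= n%:R.
      apply: (le_trans (ltW (truncnS_gt _))); rewrite ler_nat //.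
    lra.
  have [Ni ai] := aP i; have [Nj aj] := aP j.
  have := leN _ mi; have := leN _ mj; have k0 := displacement_ge0 s k.
  have Lc : len (a i) - 2 * len k <= len (k * a i * k^-1)%g.
    have := displacementM s (k^-1 * (k * a i * k^-1))%g k.
    have := displacementM s k^-1%g (k * a i * k^-1)%g.
    by rewrite displacementV !mulgA mulVg mul1g mulgVK; lra.
  have := @no_loxodromic_gromov_prod N m _ (a j) sN nolox (normN _ _ Gk Ni) Nj.
  have := gromov_prod_lip ((k * a i * k^-1)%g s) ((k * a i)%g s) (a j s) s.
  rewrite isom_mulE isom_dist.
  have -> : mdist (k^-1%g s) s = len k.
    by rewrite metric_sym -(displacementV s k).
  by rewrite /u /= /m; lra.
have uu : converges_at_infinity u by exact: uk (subgroup1 sG).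
apply: nofix; exists (boundary_point uu) => g Gg.
have uuE := boundary_pointE uu.
exact/(boundary_eqP s hypS (boundary_actE g uuE) uuE)/uk.
Qed.

End UnboundedNormal.

(** * Dynamics of a loxodromic isometry *)

Section LoxodromicDynamics.
Context (R : realType) (S : metricType R) (d : R) (s : S).
Context (hypS : delta_hyperbolic S d).
Implicit Types (x y z : S) (g h k t : isom S) (u v : nat -> S).
Implicit Types (G : set (isom S)) (xi eta : gromov_boundary S).

Local Notation gp x y := (gromov_prod x y s).
Local Notation len g := (displacement s g).

Lemma eventually_mul_gt (b c : R) : 0 < c ->
  exists N, forall n, (N <= n)%N -> b < n%:R * c.
Proof.
move=> c0; exists (Num.truncn `|b / c|).+1 => n Nn.
rewrite -ltr_pdivrMr//; apply: le_lt_trans (ler_norm _) _.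
by apply: lt_le_trans (truncnS_gt _) _; rewrite ler_nat.
Qed.

Lemma loxodromic_diverge t r : loxodromic d s t ->
  exists N, forall i j, (N <= i)%N -> (N <= j)%N ->
    r <= gp ((t ^+ i)%g s) ((t ^+ j)%g s).
Proof.
move=> ht; have [N NP] := eventually_mul_gt (r + lox_gap d s t) (lox_rate_gt0 ht).
have H i j : (N <= i)%N -> (i <= j)%N -> r <= gp ((t ^+ i)%g s) ((t ^+ j)%g s).
  move=> /NP Ni ij; have := lox_same_side hypS ht ij.
  by have := len_exp hypS i ht; lra.
exists N => i j Ni Nj; case/orP: (leq_total i j) => ij; first exact: H.
by rewrite gromov_prod_sym; exact: H.
Qed.

Lemma attracting_converges t : loxodromic d s t ->
  converges_at_infinity (fun n => (t ^+ n)%g s).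
Proof.
by move=> ht; apply/(gromov_divergeP s) => r; exact: loxodromic_diverge.
Qed.

Definition attracting t (ht : loxodromic d s t) : gromov_boundary S :=
  boundary_point (attracting_converges ht).

Definition repelling t (ht : loxodromic d s t) : gromov_boundary S :=
  attracting (loxodromicV ht).

Lemma attractingE t (ht : loxodromic d s t) :
  val (attracting ht) (fun n => (t ^+ n)%g s).
Proof. exact: boundary_pointE. Qed.

Lemma repellingE t (ht : loxodromic d s t) :
  val (repelling ht) (fun n => (t^-1 ^+ n)%g s).
Proof. exact: boundary_pointE. Qed.

Lemma attracting_fixed t (ht : loxodromic d s t) :
  boundary_act t (attracting ht) = attracting ht.
Proof.
apply/(boundary_eqP s hypS (boundary_actE t (attractingE ht)) (attractingE ht)).
apply/(gromov_divergeP s) => r; have [N NP] := loxodromic_diverge r ht.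
exists N => i j Ni Nj; rewrite /= -isom_mulE -expgS; apply: NP => //.
exact: leqW.
Qed.

Lemma repelling_fixed t (ht : loxodromic d s t) :
  boundary_act t (repelling ht) = repelling ht.
Proof.
by rewrite -[X in boundary_act _ X]attracting_fixed (boundary_actKV s hypS).
Qed.

Lemma fixed_exp t n xi :
  boundary_act t xi = xi -> boundary_act (t ^+ n)%g xi = xi.
Proof.
move=> txi; elim: n => [|n IHn]; first by rewrite expg0 (boundary_act1 s hypS).
by rewrite expgS (boundary_actM s hypS) IHn.
Qed.

(** If [u i] followed the ray as far as [t^n s], the points [t^j s] with [j >= n], lying further
    along it, would share that direction, and so would all late terms of [u]. But some late [u i']
    and [t^j s] have a product below a fixed [r]. *)
Lemma gromov_prod_ray_bounded t (ht : loxodromic d s t) xi u :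
  val xi u -> xi <> attracting ht ->
  exists B N, forall i n, (N <= i)%N -> gp (u i) ((t ^+ n)%g s) <= B.
Proof.
move=> xiu xip.
have [r rP] : exists r : R, forall N, exists i j,
    [/\ (N <= i)%N, (N <= j)%N & gp (u i) ((t ^+ j)%g s) < r].
  apply: contrapT => nr; apply: xip.
  apply/(boundary_eqP s hypS xiu (attractingE ht))/(gromov_divergeP s) => r.
  apply: contrapT => nN; apply: nr; exists r => N; apply: contrapT => nij.
  apply: nN; exists N => i j Ni Nj; rewrite leNgt; apply/negP => lt.
  by apply: nij; exists i, j.
have /(gromov_divergeP s)/(_ (r + 2 * d))[N NP] := boundary_converges xiu.
have [d0 _] := hypS.
exists (r + 2 * d + lox_gap d s t), N => i n Ni; rewrite leNgt; apply/negP => lt.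
have [i' [j]] := rP (maxn N n); rewrite !geq_max => -[/andP[Ni' _] /andP[_ nj]].
rewrite ltNge => /negP; apply.
have := gromov_prod_le (u i) ((t ^+ n)%g s) s => le1.
have := lox_same_side hypS ht nj => le2.
have le3 : r + 2 * d - d <= gp (u i) ((t ^+ j)%g s).
  apply: (hyp_le hypS (y := (t ^+ n)%g s)); last first.
    by rewrite /displacement in le2; lra.
  have : 0 <= lox_gap d s t.
    by rewrite /lox_gap; have := gromov_prod_ge0 (t s) (t^-1%g s) s; lra.
  lra.
have -> : r = r + d - d by rewrite addrK.
apply: (hyp_le hypS (y := u i)); last by lra.
by apply: le_trans (NP _ _ Ni' Ni); lra.
Qed.

Lemma gromov_prod_axis_bounded t (ht : loxodromic d s t) xi u :
  val xi u -> xi <> attracting ht -> xi <> repelling ht ->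
  exists B N, forall i m, (N <= i)%N -> gp (u i) (zpow t m s) <= B.
Proof.
move=> xiu /(gromov_prod_ray_bounded xiu)[B [N BN]].
move=> /(gromov_prod_ray_bounded xiu)[C [M CM]].
exists (Num.max B C), (maxn N M) => i m; rewrite geq_max => /andP[Ni Mi].
rewrite le_max; case: m => n; first by rewrite BN.
by rewrite /= -expVgn CM ?orbT.
Qed.

(** The images of [eta] under [t^n] tend to the attracting end, so they leave any other [xi]; the
    attracting end itself is never reached, being fixed by [t]. *)
Lemma eventually_moved t (ht : loxodromic d s t) xi eta :
  eta <> attracting ht -> eta <> repelling ht ->
  exists N, forall n, (N <= n)%N -> boundary_act (t ^+ n)%g eta <> xi.
Proof.
move=> etap etaq; have [->|xip] := pselect (xi = attracting ht).
  exists 0%N => n _ /(congr1 (boundary_act (t ^+ n)^-1%g)).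
  rewrite -[X in _ = boundary_act _ X](fixed_exp n (attracting_fixed ht)).
  by rewrite !(boundary_actK s hypS).
have [u etau] := boundary_ex eta; have [v xiv] := boundary_ex xi.
have [B [N BN]] := gromov_prod_ray_bounded xiv xip.
have [C [M CM]] := gromov_prod_ray_bounded etau etaq.
have [K KP] := eventually_mul_gt (B + C + d) (lox_rate_gt0 ht).
exists K => n /KP Kn /(boundary_eqP s hypS (boundary_actE _ etau) xiv).
move=> /(gromov_divergeP s)/(_ (B + d + 1))[L LP].
pose i := maxn L (maxn N M).
have Li : (L <= i)%N by exact: leq_maxl.
have Ni : (N <= i)%N by rewrite /i; lia.
have Mi : (M <= i)%N by rewrite /i; lia.
have := BN _ n Ni; have := CM _ n Mi; have := LP _ _ Li Li => /= l1 l2.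
have := gromov_prod_shift (t ^+ n)%g (u i) s; have := len_exp hypS n ht.
rewrite -expVgn => l3 l4; apply/negP; rewrite -ltNge.
have -> : B = B + d - d by rewrite addrK.
apply: (hyp_gt hypS (y := (t ^+ n)%g (u i))); last by lra.
by rewrite gromov_prod_sym; lra.
Qed.

Lemma attracting_neq_repelling t (ht : loxodromic d s t) :
  attracting ht <> repelling ht.
Proof.
move=> /(boundary_eqP s hypS (attractingE ht) (repellingE ht)).
move=> /(gromov_divergeP s)/(_ (lox_gap d s t + 1))[N /(_ N N (leqnn _) (leqnn _))].
by have := lox_two_sides hypS N N ht; rewrite expVgn; lra.
Qed.

(** Replacing each of the two sequences by an equivalent one costs one [d]. *)
Lemma gromov_prod_near_bounded u v a b (C : R) :
  gromov_diverge u a -> gromov_diverge v b ->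
  (forall i, gp (a i) (b i) <= C) ->
  exists N, forall i, (N <= i)%N -> gp (u i) (v i) <= C + 2 * d.
Proof.
move=> /(gromov_divergeP s)/(_ (C + 2 * d + 1))[N NP].
move=> /(gromov_divergeP s)/(_ (C + 2 * d + 1))[M MP] ab.
have [d0 _] := hypS.
exists (maxn N M) => i; rewrite geq_max => /andP[Ni Mi].
rewrite leNgt; apply/negP => lt.
have lt1 : C + 2 * d - d < gp (a i) (v i).
  apply: (hyp_gt hypS (y := u i)) => //.
  by rewrite gromov_prod_sym; have := NP _ _ Ni Ni; lra.
have lt2 : C + d - d < gp (a i) (b i).
  by apply: (hyp_gt hypS (y := v i)); [lra|have := MP _ _ Mi Mi; lra].
by have := ab i; lra.
Qed.

End LoxodromicDynamics.

(** * Limit set *)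

Section LimitSet.
Context (R : realType) (S : metricType R) (d : R) (s : S).
Context (hypS : delta_hyperbolic S d).
Implicit Types (x y z : S) (g h k t : isom S) (u v w : nat -> S).
Implicit Types (G : set (isom S)) (xi eta : gromov_boundary S).

Local Notation gp x y := (gromov_prod x y s).

Lemma gromov_prod_ext_gt (r : R) (p q : bordification S) s' :
  (r%:E < gromov_prod_ext p q s')%E ->
  exists v w, [/\ approximates v p, approximates w q & exists N, forall i j,
    (N <= i)%N -> (N <= j)%N -> r < gromov_prod (v i) (w j) s'].
Proof.
move=> /ereal_sup_gt[_ [[v w] /= [vp wq] <-]]; rewrite limf_einfE.
move=> /ereal_sup_gt[_ [V [[A B] /= [[N _ NA] [M _ MB]] AB] <-] ltV].
exists v, w; split=> //; exists (maxn N M) => i j.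
rewrite !geq_max => /andP[Ni _] /andP[_ Mj]; rewrite -lte_fin.
apply: lt_le_trans ltV _; apply: ereal_inf_lbound.
by exists (i, j) => //; apply: AB; split; [exact: NA|exact: MB].
Qed.

(** These are the points [x] at which the lower limit of [gp (u i) x] exceeds [r]; the margin [e]
    makes the set open. *)
Definition shadow u (r : R) : set S :=
  [set x | exists2 e, 0 < e & exists N, forall i, (N <= i)%N -> r + e <= gp (u i) x].

(* The largest set of boundary points that makes the union with [shadow u r]
   an open set. *)
Definition bordification_shadow u r : set (bordification S) := fun p =>
  match p with
  | inl x => shadow u r x
  | inr xi => exists r', forall v x, val xi v ->
      (exists N, forall i, (N <= i)%N -> r' <= gp (v i) x) -> shadow u r x
  end.

Lemma open_shadow u r : open (shadow u r).
Proof.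
rewrite openE => x [e e0 [N NP]]; apply/nbhs_ballP.
exists (e / 2); rewrite /= ?divr_gt0// => y; rewrite ballEmdist /= => xy.
exists (e / 2); rewrite ?divr_gt0//; exists N => i /NP.
have := gromov_prod_lip x y (u i) s.
by rewrite !(gromov_prod_sym _ (u i)); lra.
Qed.

Lemma open_bordification_shadow u r :
  bordification_open (bordification_shadow u r).
Proof.
have [d0 _] := hypS.
split; first exact: open_shadow.
move=> xi /= [r' r'P] s'; pose D := mdist s' s.
have D0 : 0 <= D by exact: mdist_ge0.
(* [D] pays for the change of base point, [1] for replacing a term of [w] by its limit in [S], and
   [2 * d] for hyperbolicity when the limit is a boundary point. *)
exists (r' + D + 2 * d + 1) => q /= /gromov_prod_ext_gt[v [w [xiv wq [N NP]]]].
case: q wq => [x|eta] /=.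
  move=> /metricType_numDomainType.cvgrPdist_lt/(_ _ ltr01)[M _ MP].
  apply: (r'P _ _ xiv); exists N => i Ni.
  have := NP i (maxn N M) Ni (leq_maxl _ _); have /= := MP (maxn N M) (leq_maxr _ _).
  have := gromov_prod_lip (w (maxn N M)) x (v i) s'.
  rewrite !(gromov_prod_sym _ (v i)) (metric_sym (w _) x).
  by have := gromov_prod_lip_base (v i) x s' s; rewrite -/D; lra.
(* One [d] is lost in passing from [v'] to [w], and another from [w] to [v]. *)
move=> etaw; exists (r' + 2 * d) => v' x etav' [M MP]; apply: (r'P _ _ xiv).
have /(boundary_eqP s hypS etaw etav')/(gromov_divergeP s) := erefl eta.
move=> /(_ (r' + 2 * d))[L LP].
pose j := maxn N (maxn M L).
have Nj : (N <= j)%N by exact: leq_maxl.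
have Mj : (M <= j)%N by rewrite /j; lia.
have Lj : (L <= j)%N by rewrite /j; lia.
exists N => i Ni; have := NP _ _ Ni Nj.
have := gromov_prod_lip_base (v i) (w j) s' s; rewrite -/D => l1 l2.
have -> : r' = r' + d - d by rewrite addrK.
apply: (hyp_le hypS (y := w j)); first by lra.
have -> : r' + d = r' + 2 * d - d by lra.
by apply: (hyp_le hypS (y := v' j)); [exact: LP|exact: MP].
Qed.

(** The shadow is a neighbourhood of [xi], so it meets the orbit of the base point [s'] that
    witnesses [xi]; moving from [s'] to [s] costs [mdist s s']. *)
Lemma limit_set_orbit G xi u r : limit_set G xi -> val xi u ->
  exists2 g, G g & exists N, forall i, (N <= i)%N -> r <= gp (u i) (g s).
Proof.
move=> [s' cl] xiu.
have oU := open_bordification_shadow u (r + mdist s s').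
have Uxi : bordification_shadow u (r + mdist s s') (inr xi).
  exists (r + mdist s s' + 1 + d) => v x xiv [N NP]; exists 1; first exact: ltr01.
  have /(boundary_eqP s hypS xiu xiv)/(gromov_divergeP s) := erefl xi.
  move=> /(_ (r + mdist s s' + 1 + d))[M MP].
  exists (maxn N M) => i; rewrite geq_max => /andP[Ni Mi].
  rewrite -[leLHS](addrK d).
  by apply: (hyp_le hypS (y := v i)); [exact: MP|exact: NP].
have [|_ [[_ [g Gg <-] <-] [e e0 [N NP]]]] :=
    cl (bordification_shadow u (r + mdist s s')).
  by apply: open_nbhs_nbhs; split.
exists g => //; exists N => i /NP.
have := gromov_prod_lip (g s') (g s) (u i) s; rewrite isom_dist.
by rewrite !(gromov_prod_sym _ (u i)) (metric_sym s' s); lra.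
Qed.

End LimitSet.

(** * Elements moving the ends of a loxodromic isometry *)

Section GoodElements.
Context (R : realType) (S : metricType R) (d : R) (s : S).
Context (hypS : delta_hyperbolic S d).
Implicit Types (x y z : S) (g h k : isom S) (u v w : nat -> S).
Implicit Types (xi eta : gromov_boundary S).
Context (t : isom S) (ht : loxodromic d s t).
Context (G : set (isom S)).
Context (sG : subgroup G) (Gt : G t).

Local Notation gp x y := (gromov_prod x y s).
Local Notation len g := (displacement s g).
Local Notation "g • xi" := (boundary_act g xi) (at level 38, right associativity).

Definition fixed_end xi : Prop :=
  xi = attracting hypS ht \/ xi = repelling hypS ht.

Lemma fixed_end_exp n xi : fixed_end xi -> (t ^+ n)%g • xi = xi.
Proof.
case=> ->; apply: (fixed_exp s hypS); first exact: attracting_fixed.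
exact: repelling_fixed.
Qed.

Lemma eventually_avoid k eta : ~ fixed_end eta ->
  exists N, forall n, (N <= n)%N -> ~ fixed_end ((k * t ^+ n)%g • eta).
Proof.
move=> neta; have [p q] : eta <> attracting hypS ht /\ eta <> repelling hypS ht.
  by split=> e; apply: neta; [left|right].
have [N NP] := eventually_moved (k^-1%g • attracting hypS ht) p q.
have [M MP] := eventually_moved (k^-1%g • repelling hypS ht) p q.
exists (maxn N M) => n; rewrite geq_max => /andP[/NP Nn /MP Mn].
rewrite (boundary_actM s hypS) => -[] e; [apply: Nn|apply: Mn].
  by rewrite -e (boundary_actK s hypS).
by rewrite -e (boundary_actK s hypS).
Qed.

Definition transverse k : Prop :=
  ~ fixed_end (k • attracting hypS ht) /\ ~ fixed_end (k • repelling hypS ht).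

(** If [G] kept one end within the pair, an element moving that end would send it to the other one;
    both ends would then have their whole orbits in the pair, contrary to the choice of [a]. *)
Lemma not_elementary_moves (a : isom S) :
  (forall xi, exists2 g, G g & g • xi <> xi) -> G a ->
  ~ fixed_end (a • attracting hypS ht) \/ ~ fixed_end (a • repelling hypS ht) ->
  (exists2 b, G b & ~ fixed_end (b • attracting hypS ht)) /\
  (exists2 b, G b & ~ fixed_end (b • repelling hypS ht)).
Proof.
move=> nofix Ga; set p := attracting _ _; set q := repelling _ _ => na.
split; apply: contrapT => nb.
  have E b : G b -> fixed_end (b • p).
    by move=> Gb; apply: contrapT => nE; apply: nb; exists b.
  case: na => na; first exact/na/E.
  have [b Gb bp] := nofix p; have [//|bq] := E _ Gb.
  by apply: na; rewrite /q -bq -(boundary_actM s hypS);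
     apply: E; apply: (subgroupM sG).
have E b : G b -> fixed_end (b • q).
  by move=> Gb; apply: contrapT => nE; apply: nb; exists b.
case: na => na; last exact/na/E.
have [b Gb bq] := nofix q; have [bp|//] := E _ Gb.
by apply: na; rewrite /p -bp -(boundary_actM s hypS);
     apply: E; apply: (subgroupM sG).
Qed.

(** When neither [b] nor [c] works, a product [x t^N y] of the two does: [t^N] fixes the end that
    [y] leaves in the pair, and [x] then expels it, while for large [N] the end expelled by [y] is
    not brought back. *)
Lemma exists_transverse (b c : isom S) : G b -> G c ->
  ~ fixed_end (b • attracting hypS ht) ->
  ~ fixed_end (c • repelling hypS ht) -> exists2 k, G k & transverse k.
Proof.
rewrite /transverse.
set p := attracting _ _; set q := repelling _ _ => Gb Gc bp cq.
have Ep : fixed_end p by left.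
have Eq : fixed_end q by right.
have [bq|bq] := pselect (fixed_end (b • q)); last by exists b.
have [cp|cp] := pselect (fixed_end (c • p)); last by exists c.
have Gtn n (x y : isom S) : G x -> G y -> G (x * t ^+ n * y)%g.
  by move=> Gx Gy; apply: subgroupM => //; apply: subgroupM => //;
     exact: subgroupX.
have actE (x : isom S) n (y : isom S) xi :
    (x * t ^+ n * y)%g • xi = (x * t ^+ n)%g • y • xi.
  by rewrite (boundary_actM s hypS).
have actF (x : isom S) n xi : fixed_end xi -> (x * t ^+ n)%g • xi = x • xi.
  by move=> xiE; rewrite (boundary_actM s hypS) fixed_end_exp.
case: (bq) => bq'.
  case: (cp) => cp'.
    have [N /(_ N (leqnn N)) NP] := eventually_avoid b cq.
    exists (b * t ^+ N * c)%g; first exact: Gtn.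
    by rewrite !actE; split=> //; rewrite actF // cp'.
  have [N /(_ N (leqnn N)) NP] := eventually_avoid c cq.
  exists (c * t ^+ N * c)%g; first exact: Gtn.
  by rewrite !actE; split=> //; rewrite actF // cp'.
have [N /(_ N (leqnn N)) NP] := eventually_avoid c bp.
exists (c * t ^+ N * b)%g; first exact: Gtn.
by rewrite !actE; split=> //; rewrite actF // bq'.
Qed.

Lemma transverse_exp k n : transverse k -> transverse (t ^+ n * k)%g.
Proof.
have H xi : ~ fixed_end xi -> ~ fixed_end ((t ^+ n)%g • xi).
  move=> nxi tE; apply: nxi; have := fixed_end_exp n tE.
  move=> /(congr1 (boundary_act (t ^+ n)^-1%g)); rewrite !(boundary_actK s hypS).
  by move=> <-.
by move=> [? ?]; split; rewrite (boundary_actM s hypS); exact: H.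
Qed.

(* [x = (x t^n k) (t^n k)^-1], and both factors are transverse for large n. *)
Lemma transverse_generate (K : set (isom S)) k : G k -> transverse k ->
  subgroup K -> (forall g, G g -> transverse g -> K g) -> G `<=` K.
Proof.
move=> Gk [kp kq] sK GK x Gx.
have [N NP] := eventually_avoid x kp; have [M MP] := eventually_avoid x kq.
have Gtk : G (t ^+ maxn N M * k)%g by apply: subgroupM => //; exact: subgroupX.
have -> : x = (x * (t ^+ maxn N M * k) * (t ^+ maxn N M * k)^-1)%g.
  by rewrite mulgK.
apply: subgroupM => //; last by apply: subgroupV => //; exact/GK/transverse_exp.
apply: GK; first exact: subgroupM.
rewrite mulgA; split; rewrite (boundary_actM s hypS).
  by apply: NP; exact: leq_maxl.
by apply: MP; exact: leq_maxr.
Qed.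

Lemma transverse_bounded k : transverse k ->
  exists B, forall m n, gp (k (zpow t m s)) (zpow t n s) <= B.
Proof.
have half u xi (g : isom S) : (forall i, mdist s (u i) <= i%:R * len t) ->
    val xi u -> ~ fixed_end (g • xi) ->
    exists B, forall (i : nat) n, gp (g (u i)) (zpow t n s) <= B.
  move=> uB xiu nE; have [p q] :
      g • xi <> attracting hypS ht /\ g • xi <> repelling hypS ht.
    by split=> e; apply: nE; [left|right].
  have [B [N BN]] := gromov_prod_axis_bounded (boundary_actE g xiu) p q.
  (* The second bound serves the terms before [N]: there the product is at most the distance from
     [s] to [g (u i)]. *)
  exists (Num.max B (len g + N%:R * len t)) => i n; rewrite le_max.
  have [Ni|iN] := leqP N i; first by rewrite BN.
  apply/orP; right; rewrite gromov_prod_sym; apply: le_trans (gromov_prod_le _ _ _) _.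
  apply: le_trans (metric_triangle _ (g s) _) _; rewrite isom_dist lerD2l.
  apply: le_trans (uB i) _; rewrite ler_wpM2r ?displacement_ge0//.
  by rewrite ler_nat ltnW.
have expB g n : len (g ^+ n)%g <= n%:R * len g.
  elim: n => [|n IHn]; first by rewrite expg0 mul0r /displacement mdistxx.
  by rewrite expgS -natr1; have := displacementM s g (g ^+ n)%g; lra.
move=> [kp kq]; have [B BP] := half _ _ _ (expB t) (attractingE hypS ht) kp.
have expBV n : len (t^-1 ^+ n)%g <= n%:R * len t.
  by rewrite -(displacementV s t).
have [C CP] := half _ _ _ expBV (repellingE hypS ht) kq.
exists (Num.max B C) => m n; rewrite le_max; case: m => m; first by rewrite BP.
by rewrite /= -expVgn CP orbT.
Qed.

(* If [G] permuted the two fixed ends of [t], the orbit of [s] would stay near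
   the axis of [t]; this contradicts the existence of a third limit point. *)
Lemma limit_point_not_fixed xi : limit_set G xi -> ~ fixed_end xi ->
  exists2 a, G a & ~ fixed_end (a • attracting hypS ht) \/
                   ~ fixed_end (a • repelling hypS ht).
Proof.
move=> Lxi nE; apply: contrapT => na.
have E a : G a ->
    fixed_end (a • attracting hypS ht) /\ fixed_end (a • repelling hypS ht).
  by move=> Ga; split; apply: contrapT => nE'; apply: na; exists a; [|left| |right].
have [p q] : xi <> attracting hypS ht /\ xi <> repelling hypS ht.
  by split=> e; apply: nE; [left|right].
have [u xiu] := boundary_ex xi.
have [B [N BN]] := gromov_prod_axis_bounded xiu p q.
have [d0 _] := hypS.
pose gap := lox_gap d s t.
(* The first term makes [g s] inherit from [u] its bounded product with the axis. The second makes
   the two ends of the axis, seen from [g s], have a product above [gap + 2 * d]. *)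
pose r := Num.max (B + d + 1) (2 * (B + d) + gap + 2 * d + 1).
have [g Gg [M MP]] := limit_set_orbit s hypS r Lxi xiu.
have rB : B + d + 1 <= r by rewrite /r le_max lexx.
have rg : 2 * (B + d) + gap + 2 * d + 1 <= r by rewrite /r le_max lexx orbT.
have gB m : gp (g s) (zpow t m s) <= B + d.
  rewrite leNgt; apply/negP => lt.
  have := MP _ (leq_maxr N M) => lt'.
  have : B < gp (u (maxn N M)) (zpow t m s).
    by rewrite -[B](addrK d); apply: (hyp_gt hypS _ lt); lra.
  by rewrite ltNge BN // leq_maxl.
have lg : r <= len g.
  by apply: le_trans (MP _ (leqnn M)) _; exact: gromov_prod_le.
have low i : r - 2 * (B + d) <=
    gp (g^-1%g ((t ^+ i)%g s)) (g^-1%g ((t^-1 ^+ i)%g s)).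
  rewrite gromov_prod_isomV invgK isom_KV.
  have := gB i; have := gB (- i%:Z); rewrite zpowN /= -expVgn /gromov_prod.
  have := metric_triangle ((t ^+ i)%g s) s ((t^-1 ^+ i)%g s).
  move: lg; rewrite /displacement !(metric_sym (g s)) (metric_sym s); lra.
have axis i : gp ((t ^+ i)%g s) ((t^-1 ^+ i)%g s) <= gap.
  by rewrite expVgn; exact: lox_two_sides.
have axis' i : gp ((t^-1 ^+ i)%g s) ((t ^+ i)%g s) <= gap.
  by rewrite gromov_prod_sym.
have [gp_ gq] := E _ (subgroupV sG Gg).
have pE := attractingE hypS ht; have qE := repellingE hypS ht.
have injg eta zeta : g^-1%g • eta = g^-1%g • zeta -> eta = zeta.
  by move=> /(congr1 (boundary_act g)); rewrite !(boundary_actKV s hypS).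
have div eta zeta v w : val eta v -> val zeta w -> g^-1%g • eta = zeta ->
    gromov_diverge ((g^-1%g : isom S) \o v) w.
  by move=> etav zetaw /(boundary_eqP s hypS (boundary_actE _ etav) zetaw).
have npq := @attracting_neq_repelling _ _ _ _ hypS _ ht.
(* As [g^-1] preserves or swaps the two ends, the images of the two rays are equivalent to the rays
   themselves in some order, so their product inherits the bound [gap] up to [2 * d]. *)
have [N' /(_ N' (leqnn N'))] : exists N, forall i, (N <= i)%N ->
    gp (g^-1%g ((t ^+ i)%g s)) (g^-1%g ((t^-1 ^+ i)%g s)) <= gap + 2 * d.
  case: gp_ gq => [gpe|gpe] [gqe|gqe].
  - by case: npq; apply: injg; rewrite gpe.
  - exact: (gromov_prod_near_bounded hypS (div _ _ _ _ pE pE gpe)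
      (div _ _ _ _ qE qE gqe) axis).
  - exact: (gromov_prod_near_bounded hypS (div _ _ _ _ pE qE gpe)
      (div _ _ _ _ qE pE gqe) axis').
  - by case: npq; apply: injg; rewrite gpe.
by have := low N'; lra.
Qed.

End GoodElements.

(** * Ping-pong along an axis *)

Section PingPongOnAxis.
Context (R : realType) (S : metricType R) (d : R) (s : S).
Context (hypS : delta_hyperbolic S d).
Context (t : isom S) (ht : loxodromic d s t).
Implicit Types (x y z : S) (k m n : int).

Local Notation gp x y := (gromov_prod x y s).
Local Notation len g := (displacement s g).

(* Points whose projection to the axis of [t] is within about [C] of [s]. *)
Definition near_base C : set S := [set y | forall m, gp y (zpow t m s) <= C].

(** For large [k], [zpow t k y] has the direction of [zpow t k s], with an error [C] from [y].
    Applying [g] costs [len g] for the base point, and [g (zpow t k s)] has product at most [B] with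
    the axis. *)
Lemma near_base_push (g : isom S) B C k y :
  (forall m n, gp (g (zpow t m s)) (zpow t n s) <= B) ->
  B + d + C + len g < len (zpow t k) ->
  near_base C y -> near_base (B + d) (g (zpow t k y)).
Proof.
move=> gB kl yC m; have [d0 _] := hypS.
rewrite leNgt; apply/negP => lt.
have sh := gromov_prod_shift (zpow t k) y s.
have := yC (- k); rewrite zpowN => yk.
have li := gromov_prod_lip_base (g (zpow t k y)) (g (zpow t k s)) (g s) s.
rewrite gromov_prod_isom (metric_sym (g s)) -/(len g) in li.
have : B + d - d < gp (g (zpow t k s)) (zpow t m s).
  by apply: (hyp_gt hypS _ lt); rewrite gromov_prod_sym; lra.
by have := gB k m; lra.
Qed.

Lemma near_base_origin : near_base 0 s.
Proof. by move=> m; rewrite gromov_prod_base. Qed.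

Context (g : nat -> isom S) (B : nat -> R) (M : nat -> nat).
Context (gB : forall i m n, gp (g i (zpow t m s)) (zpow t n s) <= B i).
Context (gVB : forall i m n, gp ((g i)^-1%g (zpow t m s)) (zpow t n s) <= B i).
Context (MB : forall i, B i + 2 * d + len (g i) < (M i)%:R * lox_rate d s t).

(* The gap between the exponents of distinct letters [a] and [b] is at least
   [M a + M b], which beats all the additive constants in [near_base_push]. *)
Let exponent i : nat := (2 * \sum_(0 <= j < i) M j + M i + 1)%N.

Let exponent_lt i j : (i < j)%N -> (exponent i + M i + M j <= exponent j)%N.
Proof.
move=> ij; rewrite /exponent (big_cat_nat (leq0n i.+1) ij) /=.
rewrite big_nat_recr //=; lia.
Qed.

Definition signed (i : nat * bool) (k : int) : int := if i.2 then k else - k.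

Definition letter_exponent (a : nat * bool) : int :=
  signed a (exponent a.1)%:Z.

Definition letter_inv (a : nat * bool) : nat * bool := (a.1, ~~ a.2).

(** The same power of [t] on both sides gives the inverse the same shape, with all signs
    reversed. *)
Definition letter (a : nat * bool) : isom S :=
  (zpow t (letter_exponent a) * zpow (g a.1) (signed a 1)
    * zpow t (letter_exponent a))%g.

Definition letter_region (a : nat * bool) : set S :=
  [set y | near_base (B a.1 + d) (zpow t (- letter_exponent a) y)].

Lemma signed_inv a k : signed (letter_inv a) k = - signed a k.
Proof. by case: a => i []; rewrite /signed /= ?opprK. Qed.

Lemma letterV a : letter (letter_inv a) = (letter a)^-1%g.
Proof.
rewrite /letter /letter_exponent !signed_inv !zpowN !invgM /=.
by rewrite mulgA.
Qed.

Lemma exponent_separated a b : b <> letter_inv a ->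
  (M a.1 + M b.1 <= absz (letter_exponent a + letter_exponent b)%R)%N.
Proof.
case: a b => [i e] [j f] ba; rewrite /letter_exponent /signed /=.
have [ij|ji|ij] := ltngtP i j.
- by have := exponent_lt ij; case: e {ba}; case: f; lia.
- by have := exponent_lt ji; case: e {ba}; case: f; lia.
(* With equal indices, [b] differs from the inverse of [a] only if the signs agree, so the exponents
   add up instead of cancelling. *)
- move: ba; rewrite ij /letter_inv /= => ba.
  have : (M j < exponent j)%N by rewrite /exponent; lia.
  by case: e ba; case: f => // _; lia.
Qed.

Lemma zpow_len k (n : nat) : (n <= absz k)%N ->
  n%:R * lox_rate d s t <= len (zpow t k).
Proof.
move=> nk; apply: le_trans (len_zpow hypS k ht).
by rewrite ler_wpM2r ?(ltW (lox_rate_gt0 ht)) // -pmulrn ler_nat.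
Qed.

(** Undoing the leading power of [t] leaves the letter's [g] or its inverse applied to a power of
    [t] whose exponent is [letter_exponent a + k]. *)
Lemma letter_push a k C y : near_base C y ->
  B a.1 + d + C + len (g a.1) < len (zpow t (letter_exponent a + k)) ->
  letter_region a (letter a (zpow t k y)).
Proof.
move=> yC kl; change (near_base (B a.1 + d)
  ((zpow t (- letter_exponent a) * (letter a * zpow t k))%g y)).
rewrite /letter !mulgA -zpowD addNr mul1g -mulgA -zpowD.
rewrite isom_mulE; apply: near_base_push yC.
  by case: a {kl} => i [] /= m n; rewrite ?expg1; [exact: gB|exact: gVB].
by case: a kl => i []; rewrite /= ?expg1 ?displacementV.
Qed.

Lemma letter_region_origin a : letter_region a (letter a s).
Proof.
rewrite -[X in letter a X]/(zpow t 0 s); apply: letter_push near_base_origin _.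
have [d0 _] := hypS.
rewrite !addr0; have := @zpow_len (letter_exponent a) (M a.1).
have : (M a.1 <= absz (letter_exponent a))%N.
  by rewrite /letter_exponent /signed /exponent; case: a.2; lia.
by move=> /[swap] /[apply]; have := MB a.1; lra.
Qed.

Lemma letter_region_step a b y : b <> letter_inv a ->
  letter_region b y -> letter_region a (letter a y).
Proof.
move=> /exponent_separated/zpow_len; rewrite natrD mulrDl => kl yb.
have -> : y = zpow t (letter_exponent b) (zpow t (- letter_exponent b) y).
  by rewrite -isom_mulE -zpowD subrr.
apply: letter_push yb _; have := MB a.1; have := MB b.1.
have := displacement_ge0 s (g b.1); have [d0 _] := hypS; lra.
Qed.

Lemma not_generated_letters : ~ generated (range letter) t.
Proof.
have [d0 _] := hypS; have r0 := lox_rate_gt0 ht.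
move=> tgen; have B0 i : 0 <= B i.
  by apply: le_trans (gB i 0 0); exact: gromov_prod_ge0.
have [t1|] : t = 1%g \/ exists a, letter_region a (t s).
- apply: (ping_pong (act := @isom_fun R S) (inv := letter_inv) (h := letter)) => //.
  + exact: letterV.
  + exact: letter_region_origin.
  + by move=> a b y; exact: letter_region_step.
- have : len t = 0 by rewrite t1 /displacement isom_1E mdistxx.
  by have := len_exp hypS 1 ht; rewrite expg1; lra.
(* This test point on the axis is the translate of [t s] itself, so the product is its full distance
   from [s]. *)
move=> [a /(_ (1 - letter_exponent a))]; rewrite -isom_mulE.
have -> : (zpow t (- letter_exponent a) * t)%g = zpow t (1 - letter_exponent a).
  by rewrite addrC zpowS.
rewrite gromov_prod_diag -/(len _).
(* The final [+ 1] in [exponent] absorbs the shift by one here. *)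
have : (M a.1 <= absz (1 - letter_exponent a)%R)%N.
  by rewrite /letter_exponent /signed /exponent; case: a.2; lia.
move=> /zpow_len; have := MB a.1; have := displacement_ge0 s (g a.1).
lra.
Qed.

End PingPongOnAxis.

(** * Frattini subgroup of a group of general type *)

Lemma countable_enum (T : choiceType) (A : set T) : countable A -> A !=set0 ->
  exists f : nat -> T, (forall n, A (f n)) /\ forall x, A x -> exists n, f n = x.
Proof.
move=> /countable_injP[h injh] [a Aa].
have /choice[f fP] : forall n, exists x, A x /\ forall y, A y -> h y = n -> y = x.
  move=> n; have [[x [Ax hx]]|nx] := pselect (exists x, A x /\ h x = n).
    by exists x; split=> // y Ay hy; apply: injh; rewrite ?inE// hx.
  (* Indices not attained by [h] receive the default value [a]. *)
  by exists a; split=> // y Ay hy; exfalso; apply: nx; exists y.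
exists f; split=> [n|x Ax]; first by have [] := fP n.
by exists (h x); have [_ /(_ x Ax erefl)] := fP (h x).
Qed.

Lemma limit_set_nonempty (R : realType) (S : metricType R) (G : set (isom S)) :
  non_elementary G -> limit_set G !=set0.
Proof.
move=> neG; apply: contrapT => nxi; move: neG; rewrite /non_elementary.
have -> : limit_set G = set0.
  by apply/seteqP; split=> // xi Lxi; apply: nxi; exists xi.
by rewrite card_le0 => /eqP/seteqP[/(_ 0%N) + _]; apply.
Qed.

Section FrattiniGeneralType.
Context (R : realType) (S : metricType R) (d : R) (s : S).
Context (hypS : delta_hyperbolic S d).
Implicit Types (G : set (isom S)) (t : isom S).

Local Notation len g := (displacement s g).

(** Otherwise the limit set would lie in the image of a two-element set. *)
Lemma limit_point_outside G t (ht : loxodromic d s t) :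
  non_elementary G -> exists2 xi, limit_set G xi & ~ fixed_end hypS ht xi.
Proof.
move=> neG; apply: contrapT => nxi; move: neG; apply/negP.
pose f n := if n is 0%N then attracting hypS ht else repelling hypS ht.
have sub : limit_set G `<=` f @` `I_2.
  move=> xi Lxi; have [] : fixed_end hypS ht xi.
  - by apply: contrapT => nE; apply: nxi; exists xi.
  - by move=> ->; exists 0%N.
  - by move=> ->; exists 1%N.
apply/negP => I3.
have := card_le_trans I3 (card_le_trans (subset_card_le sub) (card_image_le f `I_2)).
by rewrite card_le_II.
Qed.

Lemma frattini_not_loxodromic G t : subgroup G -> countable G ->
  general_type G -> frattini G t -> ~ loxodromic d s t.
Proof.
move=> sG cG [neG nofix] phit ht; have Gt := frattini_sub phit.
have [d0 _] := hypS.
have nofix' xi : exists2 g, G g & boundary_act g xi <> xi.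
  apply: contrapT => nf; apply: nofix; exists xi => g Gg.
  by apply: contrapT => ng; apply: nf; exists g.
have [xi Lxi nxi] := limit_point_outside ht neG.
have [a Ga na] := limit_point_not_fixed sG Lxi nxi.
have [[b Gb nb] [c Gc nc]] := not_elementary_moves sG nofix' Ga na.
have [k Gk kT] := exists_transverse sG Gt Gb Gc nb nc.
pose A := G `&` [set g | transverse hypS ht g].
have cA : countable A.
  by apply: sub_countable cG; apply: subset_card_le => g [].
have [g [gA gsurj]] : exists f : nat -> isom S, (forall n, A (f n)) /\
    forall x, A x -> exists n, f n = x.
  by apply: countable_enum => //; exists k.
have /choice[B BP] i : exists B,
    forall m n, gromov_prod (g i (zpow t m s)) (zpow t n s) s <= B.
  by have [_ /transverse_bounded] := gA i.
(* The extra [len (g i)] makes the bound valid for the inverse of [g i] as well, where the base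
   point moves to [g i s]. *)
pose C i := B i + len (g i).
have gC i m n : gromov_prod (g i (zpow t m s)) (zpow t n s) s <= C i.
  by have := BP i m n; have := displacement_ge0 s (g i); rewrite /C; lra.
have gVC i m n : gromov_prod ((g i)^-1%g (zpow t m s)) (zpow t n s) s <= C i.
  rewrite gromov_prod_isomV invgK gromov_prod_sym.
  have := gromov_prod_lip_base (g i (zpow t n s)) (zpow t m s) (g i s) s.
  by rewrite (metric_sym (g i s)) -/(len (g i)); have := BP i n m; rewrite /C; lra.
have /choice[M MP] i : exists M : nat,
    C i + 2 * d + len (g i) < M%:R * lox_rate d s t.
  have [M MP] := eventually_mul_gt (C i + 2 * d + len (g i)) (lox_rate_gt0 ht).
  by exists M; exact: MP.
have gG i : G (g i) by have [] := gA i.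
apply: (not_generated_letters hypS ht gC gVC MP).
apply: (frattini_nongenerator sG) phit.
- exact: subgroup_generated.
- apply: generated_min => // _ [i _ <-]; rewrite /letter.
  by do 2?[apply: (subgroupM sG)]; apply: (subgroup_zpow _ sG).
(* A subgroup containing [t] and the letters recovers every [g i] by stripping the powers of [t],
   hence contains all transverse elements, which generate [G]. *)
- move=> K sK KG HK Kt; apply/seteqP; split=> //.
  apply: (transverse_generate sG Gt Gk kT sK) => x Gx xT.
  have [i <-] := gsurj x (conj Gx xT).
  have Kl : K (letter t g M (i, true)).
    by apply: HK; apply: sub_generated; exists (i, true).
  pose e := letter_exponent M (i, true).
  have -> : g i = (zpow t (- e) * letter t g M (i, true) * zpow t (- e))%g.
    have -> : letter t g M (i, true) = (zpow t e * g i * zpow t e)%g by [].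
    by rewrite !mulgA -zpowD addNr mul1g -mulgA -zpowD subrr mulg1.
  by do 2?[apply: (subgroupM sK)] => //; apply: (subgroup_zpow _ sK).
Qed.

Lemma non_elementary_unbounded G r : non_elementary G ->
  exists2 g, G g & r <= len g.
Proof.
move=> /limit_set_nonempty[xi Lxi].
have [u xiu] := boundary_ex xi.
have [g Gg [N NP]] := limit_set_orbit s hypS r Lxi xiu.
by exists g => //; apply: le_trans (NP _ (leqnn N)) _; exact: gromov_prod_le.
Qed.

Lemma frattini_bounded G : subgroup G -> countable G -> general_type G ->
  exists r, forall g, frattini G g -> len g <= r.
Proof.
move=> sG cG gtG; apply: contrapT => nr.
have unb r : exists2 g, frattini G g & r <= len g.
  apply: contrapT => ng; apply: nr; exists r => g phig.
  by rewrite leNgt; apply/negP => lt; apply: ng; exists g => //; exact: ltW.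
have [//|t phit] := unbounded_normal_loxodromic hypS sG (subgroup_frattini sG)
  (@frattini_sub _ G) _ unb gtG.2.
  by move=> g h Gg phih; exact: frattini_conj.
exact: (frattini_not_loxodromic sG cG gtG phit).
Qed.

(** On the coset of [g], lengths are at most [len g + r]; finitely many such bounds have a
    maximum. *)
Lemma finite_cosets_bounded G H r : subgroup H ->
  (forall h, H h -> len h <= r) -> finite_set (left_cosets G H) ->
  exists r', forall g, G g -> len g <= r'.
Proof.
move=> sH Hr /finite_seqP[cs csE].
have csP C : C \in cs -> exists r', forall g, C g -> len g <= r'.
  move=> Ccs; have : left_cosets G H C by rewrite csE.
  case=> g Gg <-; exists (len g + r) => _ [h Hh <-].
  by apply: le_trans (displacementM _ _ _) _; rewrite lerD2l; exact: Hr.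
have [r' r'P] : exists r', forall C g, C \in cs -> C g -> len g <= r'.
  elim: (cs) csP => [_|C l IHl lP]; first by exists 0.
  have [|r1 r1P] := IHl; first by move=> D Dl; apply: lP; rewrite inE Dl orbT.
  have [|r2 r2P] := lP C; first by rewrite inE eqxx.
  exists (Num.max r1 r2) => D g; rewrite inE le_max => /orP[/eqP ->|Dl] Dg.
    by rewrite r2P // orbT.
  by rewrite (r1P D).
exists r' => g Gg; apply: (r'P [set (g * h)%g | h in H]).
  have : left_cosets G H [set (g * h)%g | h in H] by exists g.
  by rewrite csE.
by exists 1%g; [exact: subgroup1|rewrite mulg1].
Qed.

End FrattiniGeneralType.

Theorem theorem1p2 (R : realType) (S : metricType R) (G : set (isom S))
    (hS : hyperbolic S) (hG : subgroup G) (cG : countable G)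
    (gtG : general_type G) :
  bounded_orbits (frattini G) /\
  infinite_set (left_cosets G (frattini G)).
Proof.
have [d hypS] := hyperbolicP hS; split=> [s|fin].
  have [r rP] := frattini_bounded s hypS hG cG gtG.
  exists (r + r) => _ _ [g phig <-] [h phih <-].
  apply: le_trans (metric_triangle _ s _) _; rewrite metric_sym.
  by apply: lerD; exact: rP.
(* The base point is extracted from a limit point, which also shows that [S] is inhabited. *)
have [_ [s _]] := limit_set_nonempty gtG.1.
have [r rP] := frattini_bounded s hypS hG cG gtG.
have [r' r'P] := finite_cosets_bounded (subgroup_frattini hG) rP fin.
have [g Gg] := non_elementary_unbounded s hypS (r' + 1) gtG.1.
by have := r'P _ Gg; lra.
Qed.
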